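(* Let $\alpha\in[0,1)$ and let $A=\{A_n\}_{n\ge 0}$ be a finitely supported complex sequence with $A_0=0$. Define $w_1(\alpha)=1+2^{\alpha}-2^{\frac{1+\alpha}{2}}$ and, for $n\ge 2$, $$w_n(\alpha)=n^{\alpha}\Big[1+\Big(1+\frac1n\Big)^{\alpha}-\Big(1-\frac1n\Big)^{\frac{1-\alpha}{2}}-\Big(1+\frac1n\Big)^{\frac{1+\alpha}{2}}\Big].$$ Then $$\sum_{n=1}^{\infty}|A_n-A_{n-1}|^2 n^{\alpha}\ \ge\ \sum_{n=1}^{\infty}w_n(\alpha)|A_n|^2\ >\ \frac{(\alpha-1)^2}{4}\sum_{n=1}^{\infty}\frac{|A_n|^2}{n^2}n^{\alpha}.$$
   Context: A sequence $\{A_n\}_{n\ge0}$ is finitely supported if $A_n\ne0$ for only finitely many $n$.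
   Formalization: The strict second inequality is asserted only when some A_n is nonzero, since for the zero sequence it would read 0 > 0; the first inequality is asserted for every A. *)

(* Defs.v *)
From Stdlib Require Import Reals List.
From Coquelicot Require Import Coquelicot.

Open Scope R_scope.

Definition finitely_supported (A : nat -> C) : Prop :=
  exists l : list nat, forall n : nat, A n <> RtoC 0 -> In n l.

(** The sum of [a n] over [n >= 1]. *)
Definition Series1 (a : nat -> R) : R := Series (fun k : nat => a (S k)).

(** Case [n = 1] is separate because [Rpower 0 y] is [1] (as [ln 0 = 0]), not
    [0]. The value at [n = 0] is irrelevant: weights are only used for
    [n >= 1]. *)
Definition hardy_weight (alpha : R) (n : nat) : R :=
  match n with
  | 1%nat => 1 + Rpower 2 alpha - Rpower 2 ((1 + alpha) / 2)
  | _ =>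
      Rpower (INR n) alpha *
      (1 + Rpower (1 + 1 / INR n) alpha
         - Rpower (1 - 1 / INR n) ((1 - alpha) / 2)
         - Rpower (1 + 1 / INR n) ((1 + alpha) / 2))
  end.

(* Main.v *)
Require Import Defs.
From Stdlib Require Import Reals List Lra Lia.
From Coquelicot Require Import Coquelicot.

Open Scope R_scope.

(** With [beta = (1 - alpha) / 2], the function [n ^ beta] is a positive
    solution of the Euler equation of the form [Sum |A_n - A_(n-1)|^2 n^alpha]
    with potential [w_n]. Expanding [|A_n - A_(n-1)|^2] around this ground state
    bounds each term from below by [w_n |A_n|^2] plus a telescoping flux.
    The second inequality holds term by term: with [x = 1 / n] it reads
    [1 - (1 - x)^beta - (1 + x)^(1 - 2 beta) * ((1 + x)^beta - 1) > beta^2 x^2],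
    which follows from the cubic Taylor bound for [(1 + y)^beta] on both sides
    of [y = 0] and from Bernoulli's inequality. *)

(** * Upper bounds for powers of [1 + y] *)

(* The quotient [G y / (1 + y)^b] equals 1 at 0, and its derivative has the
   sign of [y]. *)
Lemma Rpower_lt_of_derive (G dG : R -> R) (b y : R) :
  (forall z, is_derive G z (dG z)) ->
  G 0 = 1 ->
  (forall z, -1 < z -> z <> 0 -> 0 < z * ((1 + z) * dG z - b * G z)) ->
  -1 < y -> y <> 0 ->
  Rpower (1 + y) b < G y.
Proof.
  intros HG HG0 Hsign Hy Hy0.
  set (k := fun z => G z * Rpower (1 + z) (- b)).
  set (dk := fun z =>
         Rpower (1 + z) (- b) / (1 + z) * ((1 + z) * dG z - b * G z)).
  assert (Hk : forall z, -1 < z -> is_derive k z (dk z)).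
  { intros z Hz. unfold k, dk, Rpower.
    auto_derive.
    - split; [exists (dG z); apply HG | lra].
    - replace (Derive (fun x => G x) z) with (dG z)
        by (symmetry; apply is_derive_unique, HG).
      field. lra. }
  assert (Hk0 : k 0 = 1).
  { unfold k. rewrite HG0, Rplus_0_r. unfold Rpower.
    rewrite ln_1, Rmult_0_r, exp_0. ring. }
  (* The intermediate point lies strictly between 0 and [y], so [c * y > 0] treats both signs of [y]
     at once. *)
  assert (Hc : exists c, -1 < c /\ c * y > 0 /\ k y - k 0 = dk c * y).
  { destruct (Rlt_or_le y 0) as [Hneg | Hpos].
    - destruct (MVT_cor2 k dk y 0 Hneg) as [c [Hc1 Hc2]].
      { intros z Hz. apply is_derive_Reals, Hk. lra. }
      exists c. split; [lra | split; [nra | lra]].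
    - destruct (MVT_cor2 k dk 0 y) as [c [Hc1 Hc2]]; [lra | |].
      { intros z Hz. apply is_derive_Reals, Hk. lra. }
      exists c. split; [lra | split; [nra | lra]]. }
  destruct Hc as [c [Hc1 [Hcy Heq]]].
  assert (Hcn : c <> 0) by (intros ->; lra).
  pose proof (Hsign c Hc1 Hcn) as Hs.
  assert (Hky : 1 < k y).
  { assert (0 < dk c * y); [| lra].
    unfold dk. set (S := (1 + c) * dG c - b * G c) in *.
    assert (HP : 0 < Rpower (1 + c) (- b) / (1 + c)).
    { apply Rdiv_lt_0_compat; [apply exp_pos | lra]. }
    rewrite Rmult_assoc. apply Rmult_lt_0_compat; [exact HP |].
    assert (0 < (c * c) * (S * y)) by (replace (c * c * (S * y))
      with ((c * S) * (c * y)) by ring; nra).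
    assert (0 < c * c) by nra.
    apply (Rmult_lt_reg_l (c * c)); lra. }
  unfold k in Hky. rewrite Rpower_Ropp in Hky.
  pose proof (exp_pos (b * ln (1 + y))) as HE. fold (Rpower (1 + y) b) in HE.
  apply (Rmult_lt_compat_r _ _ _ HE) in Hky.
  rewrite Rmult_assoc, Rinv_l in Hky; lra.
Qed.

Lemma Rpower_le_bernoulli (g y : R) :
  0 <= g < 1 -> 0 < y -> Rpower (1 + y) g <= 1 + g * y.
Proof.
  (* At [g = 0] both sides equal 1, out of reach of the strict comparison. *)
  intros Hg Hy. destruct (Req_dec g 0) as [-> | Hg0].
  { rewrite Rpower_O; lra. }
  apply Rlt_le.
  apply (Rpower_lt_of_derive (fun z => 1 + g * z) (fun _ => g)); try lra.
  - intros z. auto_derive; [trivial | ring].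
  - intros z _ Hz.
    replace (z * ((1 + z) * g - g * (1 + g * z)))
      with (g * (1 - g) * (z * z)) by ring.
    apply Rmult_lt_0_compat; nra.
Qed.

(** For a Taylor polynomial [G] of [(1 + z)^b], all terms of [(1 + z) * G' - b * G] cancel except
    the top one. Here that is a positive multiple of [z^3], which has the sign of [z]. *)
Lemma Rpower_lt_cubic (b y : R) :
  0 < b < 1 -> -1 < y -> y <> 0 ->
  Rpower (1 + y) b <
    1 + b * y - b * (1 - b) / 2 * y ^ 2 + b * (1 - b) * (2 - b) / 6 * y ^ 3.
Proof.
  intros Hb Hy Hy0.
  apply (Rpower_lt_of_derive
    (fun y => 1 + b * y - b * (1 - b) / 2 * y ^ 2
              + b * (1 - b) * (2 - b) / 6 * y ^ 3)
    (fun y => b - b * (1 - b) * y + b * (1 - b) * (2 - b) / 2 * y ^ 2));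
    try assumption.
  - intros z. auto_derive; [trivial | field].
  - field.
  - intros z _ Hz.
    match goal with |- 0 < ?e => replace e
      with (b * ((1 - b) * ((2 - b) * ((3 - b) / 6))) * ((z * z) * (z * z)))
      by field end.
    assert (0 < z * z) by nra.
    apply Rmult_lt_0_compat; [| nra].
    repeat apply Rmult_lt_0_compat; lra.
Qed.

(** * Termwise strict lower bound for the weight *)

Lemma weight_profile_gt (alpha x : R) :
  0 <= alpha < 1 -> 0 < x < 1 ->
  (alpha - 1) ^ 2 / 4 * x ^ 2 <
  1 + Rpower (1 + x) alpha - Rpower (1 - x) ((1 - alpha) / 2)
    - Rpower (1 + x) ((1 + alpha) / 2).
Proof.
  intros Ha Hx.
  set (b := (1 - alpha) / 2).
  assert (Hb : 0 < b <= 1 / 2) by (unfold b; lra).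
  replace ((1 + alpha) / 2) with (alpha + b) by (unfold b; field).
  assert (Hal : alpha = 1 - 2 * b) by (unfold b; field).
  clearbody b. subst alpha.
  rewrite Rpower_plus.
  pose proof (Rpower_lt_cubic b x ltac:(lra) ltac:(lra) ltac:(lra)) as HQ.
  pose proof (Rpower_lt_cubic b (- x) ltac:(lra) ltac:(lra) ltac:(lra)) as HP.
  replace (1 + - x) with (1 - x) in HP by ring.
  pose proof (Rpower_le_bernoulli (1 - 2 * b) x ltac:(lra) ltac:(lra)) as HR.
  pose proof (exp_pos ((1 - 2 * b) * ln (1 + x))) as HR0.
  fold (Rpower (1 + x) (1 - 2 * b)) in HR0.
  set (P := Rpower (1 - x) b) in *.
  set (Q := Rpower (1 + x) b) in *.
  set (U := Rpower (1 + x) (1 - 2 * b)) in *.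
  set (q := b * x - b * (1 - b) / 2 * x ^ 2
            + b * (1 - b) * (2 - b) / 6 * x ^ 3) in *.
  (* The sign of [q] is what allows replacing [U] by its Bernoulli bound in the product [U * q]. *)
  assert (Hq0 : 0 <= q).
  { replace q with (b * x * (1 - (1 - b) / 2 * x
      + (1 - b) * (2 - b) / 6 * (x * x))) by (unfold q; field).
    apply Rmult_le_pos; [nra |].
    assert ((1 - b) / 2 * x <= 1) by nra.
    assert (0 <= (1 - b) * (2 - b) / 6 * (x * x)) by (apply Rmult_le_pos; nra).
    lra. }
  assert (H1 : U * (Q - 1) <= (1 + (1 - 2 * b) * x) * q).
  { apply Rle_trans with (U * q).
    - apply Rmult_le_compat_l; [lra |]. unfold q. lra.
    - apply Rmult_le_compat_r; lra. }
  (* The surplus over [b^2 * x^2] once all bounds are inserted; the last factor is positive since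
     [(2 - b) * x < 2]. Strictness of the final estimate comes from [HP]. *)
  assert (H2 : 0 <= (1 - 2 * b) * b * (1 - b) * x ^ 3 * (1 / 2 - (2 - b) * x / 6)).
  { assert (0 <= x ^ 3) by (apply pow_le; lra).
    repeat apply Rmult_le_pos; try lra; nra. }
  unfold q in H1.
  assert (H3 : (1 - 2 * b - 1) ^ 2 / 4 * x ^ 2 =
    (b * x + b * (1 - b) / 2 * x ^ 2 + b * (1 - b) * (2 - b) / 6 * x ^ 3)
    - (1 + (1 - 2 * b) * x) * (b * x - b * (1 - b) / 2 * x ^ 2
            + b * (1 - b) * (2 - b) / 6 * x ^ 3)
    - (1 - 2 * b) * b * (1 - b) * x ^ 3 * (1 / 2 - (2 - b) * x / 6)) by field.
  rewrite H3.
  replace ((- x) ^ 2) with (x ^ 2) in HP by ring.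
  replace ((- x) ^ 3) with (- x ^ 3) in HP by ring.
  lra.
Qed.

Lemma hardy_weight_SS (alpha : R) (m : nat) :
  let n := INR (S (S m)) in
  hardy_weight alpha (S (S m)) =
  Rpower n alpha * (1 + Rpower (1 + 1 / n) alpha
    - Rpower (1 - 1 / n) ((1 - alpha) / 2)
    - Rpower (1 + 1 / n) ((1 + alpha) / 2)).
Proof. reflexivity. Qed.

Lemma hardy_weight_gt (alpha : R) (n : nat) :
  0 <= alpha < 1 -> (1 <= n)%nat ->
  (alpha - 1) ^ 2 / 4 * (Rpower (INR n) alpha / INR n ^ 2)
    < hardy_weight alpha n.
Proof.
  intros Ha Hn. destruct n as [| [| m]]; [lia | |].
  - simpl hardy_weight. simpl INR.
    assert (H1 : Rpower 1 alpha = 1)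
      by (unfold Rpower; rewrite ln_1, Rmult_0_r; apply exp_0).
    rewrite H1.
    (* With [v = 2^((alpha - 1) / 2)] the weight is [1 + 2 v^2 - 2 v >= 1/2]. *)
    set (v := Rpower 2 ((alpha - 1) / 2)).
    replace (Rpower 2 alpha) with (2 * (v * v)).
    2:{ unfold v. rewrite <- Rpower_plus.
        rewrite <- (Rpower_1 2) at 1 by lra. rewrite <- Rpower_plus.
        f_equal. field. }
    replace (Rpower 2 ((1 + alpha) / 2)) with (2 * v).
    2:{ unfold v. rewrite <- (Rpower_1 2) at 1 by lra. rewrite <- Rpower_plus.
        f_equal. field. }
    assert ((alpha - 1) ^ 2 <= 1) by nra.
    assert (0 <= (2 * v - 1) ^ 2) by apply pow2_ge_0.
    lra.
  - rewrite hardy_weight_SS.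
    assert (Hn2 : 2 <= INR (S (S m))).
    { change 2 with (INR 2). apply le_INR. lia. }
    set (n := INR (S (S m))) in *.
    replace ((alpha - 1) ^ 2 / 4 * (Rpower n alpha / n ^ 2))
      with (Rpower n alpha * ((alpha - 1) ^ 2 / 4 * (1 / n) ^ 2))
      by (field; lra).
    apply Rmult_lt_compat_l; [apply exp_pos |].
    apply weight_profile_gt; [exact Ha |].
    split.
    + apply Rdiv_lt_0_compat; lra.
    + apply (Rmult_lt_reg_r n); [lra |].
      replace (1 / n * n) with 1 by (field; lra). lra.
Qed.

(** * The ground state and its flux *)

(** For [n >= 1], the ratio [u (n + 1) / u n] of the ground state [u n = n^((1 - alpha) / 2)]. *)
Definition growth (alpha : R) (n : nat) : R :=
  Rpower (1 + 1 / INR n) ((1 - alpha) / 2).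

Definition flux (alpha : R) (n : nat) : R :=
  Rpower (INR (S n)) alpha * (growth alpha n - 1).

Lemma Rpower_succ (n y : R) :
  0 < n -> Rpower n y * Rpower (1 + 1 / n) y = Rpower (n + 1) y.
Proof.
  intros Hn. assert (0 < 1 / n) by (apply Rdiv_lt_0_compat; lra).
  rewrite Rpower_mult_distr by lra. f_equal. field. lra.
Qed.

(** Since [(1 + alpha) / 2 = alpha + (1 - alpha) / 2], the factor [(1 + 1 / n)^alpha] splits off and
    turns [n^alpha] into [(n + 1)^alpha]. *)
Lemma hardy_weight_outflux (alpha : R) (n : nat) :
  (1 <= n)%nat ->
  Rpower (INR n) alpha *
    (Rpower (1 + 1 / INR n) ((1 + alpha) / 2) - Rpower (1 + 1 / INR n) alpha)
  = flux alpha n.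
Proof.
  intros Hn. unfold flux, growth.
  assert (Hn' : 0 < INR n) by (apply lt_0_INR; lia).
  rewrite S_INR, <- Rpower_succ by exact Hn'.
  replace ((1 + alpha) / 2) with (alpha + (1 - alpha) / 2) by field.
  rewrite Rpower_plus. ring.
Qed.

(** The ground state is 0 at [n = 0], so the edge from 0 to 1 contributes its full coefficient 1. *)
Lemma hardy_weight_1 (alpha : R) : hardy_weight alpha 1 = 1 - flux alpha 1.
Proof.
  rewrite <- hardy_weight_outflux by lia. simpl hardy_weight. simpl INR.
  replace (Rpower 1 alpha) with 1
    by (unfold Rpower; rewrite ln_1, Rmult_0_r; symmetry; apply exp_0).
  replace (1 + 1 / 1) with 2 by field. ring.
Qed.

(** The Euler equation of the ground state: [1 - 1 / (n + 1)] is the inverse of [1 + 1 / n], so the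
    backward power in the weight is [/ growth alpha n]. *)
Lemma hardy_weight_succ (alpha : R) (n : nat) :
  (1 <= n)%nat ->
  hardy_weight alpha (S n) =
  Rpower (INR (S n)) alpha * (1 - / growth alpha n) - flux alpha (S n).
Proof.
  intros Hn. destruct n as [| m]; [lia |].
  rewrite <- hardy_weight_outflux, hardy_weight_SS by lia.
  cbv zeta.
  replace (/ growth alpha (S m))
    with (Rpower (1 - 1 / INR (S (S m))) ((1 - alpha) / 2)); [ring |].
  unfold growth. rewrite <- Rpower_Ropp.
  assert (Hm : 0 < INR (S m)) by (apply lt_0_INR; lia).
  rewrite (S_INR (S m)).
  unfold Rpower. f_equal.
  replace (1 - 1 / (INR (S m) + 1)) with (/ (1 + 1 / INR (S m)))
    by (field; lra).
  rewrite ln_Rinv; [ring |].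
  assert (0 < 1 / INR (S m)) by (apply Rdiv_lt_0_compat; lra). lra.
Qed.

(** * Edgewise expansion and telescoping *)

Lemma Cmod_sqr (z : C) : Cmod z ^ 2 = fst z ^ 2 + snd z ^ 2.
Proof.
  unfold Cmod. apply pow2_sqrt.
  pose proof (pow2_ge_0 (fst z)). pose proof (pow2_ge_0 (snd z)). lra.
Qed.

(* The difference of the two sides is [r * |u / r - v|^2]. *)
Lemma Cmod_minus_sqr_ge (u v : C) (r : R) :
  0 < r ->
  (1 - / r) * Cmod u ^ 2 - (r - 1) * Cmod v ^ 2 <= Cmod (Cminus u v) ^ 2.
Proof.
  intros Hr. rewrite !Cmod_sqr. destruct u as [a b], v as [c d]. simpl fst. simpl snd.
  assert (0 <= r * ((a / r - c) ^ 2 + (b / r - d) ^ 2)).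
  { apply Rmult_le_pos; [lra |].
    pose proof (pow2_ge_0 (a / r - c)). pose proof (pow2_ge_0 (b / r - d)). lra. }
  match goal with |- ?L <= ?R =>
    replace R with (L + r * ((a / r - c) ^ 2 + (b / r - d) ^ 2)) by (field; lra)
  end.
  lra.
Qed.

(** Taking [r = growth alpha n] on the edge from [n] to [n + 1] costs exactly
    [flux alpha n * |A_n|^2], the boundary term carried by the induction. *)
Lemma partial_hardy (alpha : R) (A : nat -> C) (N : nat) :
  A 0%nat = RtoC 0 ->
  sum_f_R0 (fun k => hardy_weight alpha (S k) * Cmod (A (S k)) ^ 2) N
    + flux alpha (S N) * Cmod (A (S N)) ^ 2
  <= sum_f_R0 (fun k => Cmod (Cminus (A (S k)) (A (S k - 1)%nat)) ^ 2
                        * Rpower (INR (S k)) alpha) N.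
Proof.
  intros HA0. induction N as [| N IH].
  - unfold sum_f_R0. rewrite hardy_weight_1. simpl Nat.sub. rewrite HA0.
    simpl INR.
    replace (Rpower 1 alpha) with 1
      by (unfold Rpower; rewrite ln_1, Rmult_0_r; symmetry; apply exp_0).
    replace (Cminus (A 1%nat) (RtoC 0)) with (A 1%nat) by ring.
    lra.
  - rewrite !tech5.
    rewrite (hardy_weight_succ alpha (S N)) by lia.
    replace (S (S N) - 1)%nat with (S N) by lia.
    pose proof (Cmod_minus_sqr_ge (A (S (S N))) (A (S N)) (growth alpha (S N))
      (exp_pos _)) as H.
    pose proof (exp_pos (alpha * ln (INR (S (S N))))) as HP.
    fold (Rpower (INR (S (S N))) alpha) in HP.
    apply (Rmult_le_compat_r _ _ _ (Rlt_le _ _ HP)) in H.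
    unfold flux at 1 in IH. lra.
Qed.

(** * Reduction of the series to finite sums *)

Lemma Series_eventually_0 (a : nat -> R) (N : nat) :
  (forall k, (N < k)%nat -> a k = 0) -> Series a = sum_f_R0 a N.
Proof.
  intros Ha. apply is_series_unique.
  change (is_lim_seq (sum_n a) (sum_f_R0 a N)).
  apply (is_lim_seq_ext_loc (fun _ => sum_f_R0 a N)); [| apply is_lim_seq_const].
  exists N. intros n Hn. rewrite sum_n_Reals.
  induction Hn as [| n Hn IH]; [reflexivity |].
  rewrite tech5, <- IH, Ha by lia. ring.
Qed.

Lemma sum_f_R0_lt (a b : nat -> R) (N j : nat) :
  (forall k, a k <= b k) -> (j <= N)%nat -> a j < b j ->
  sum_f_R0 a N < sum_f_R0 b N.
Proof.
  intros Hab Hj Hlt. induction Hj as [| N Hj IH].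
  - destruct j as [| j]; [exact Hlt |].
    rewrite !tech5. apply Rplus_le_lt_compat; [| exact Hlt].
    apply sum_Rle. intros; apply Hab.
  - rewrite !tech5. apply Rplus_lt_le_compat; [exact IH | apply Hab].
Qed.

Lemma finitely_supported_bound (A : nat -> C) :
  finitely_supported A ->
  exists N, forall n, (N < n)%nat -> A n = RtoC 0.
Proof.
  intros [l Hl]. exists (list_max l). intros n Hn.
  destruct (Ceq_dec (A n) (RtoC 0)) as [H | H]; [exact H |].
  exfalso. pose proof (list_max_le l (list_max l)) as [Hm _].
  specialize (Hm (le_n _)). rewrite Forall_forall in Hm.
  specialize (Hm n (Hl n H)). lia.
Qed.

Theorem theorem2p2 (alpha : R) (A : nat -> C)
  (halpha : 0 <= alpha < 1)
  (hfin : finitely_supported A)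
  (hA0 : A 0%nat = RtoC 0) :
  Series1 (fun n : nat =>
      Cmod (Cminus (A n) (A (n - 1)%nat)) ^ 2 * Rpower (INR n) alpha)
    >= Series1 (fun n : nat => hardy_weight alpha n * Cmod (A n) ^ 2)
  /\
  ((exists n : nat, A n <> RtoC 0) ->
   Series1 (fun n : nat => hardy_weight alpha n * Cmod (A n) ^ 2)
     > (alpha - 1) ^ 2 / 4 *
       Series1 (fun n : nat =>
         Cmod (A n) ^ 2 / INR n ^ 2 * Rpower (INR n) alpha)).
Proof.
  destruct (finitely_supported_bound A hfin) as [N HN].
  unfold Series1.
  rewrite (Series_eventually_0
    (fun k => hardy_weight alpha (S k) * Cmod (A (S k)) ^ 2) N)
    by (intros k Hk; rewrite (HN (S k)), Cmod_0 by lia; ring).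
  split.
  (* Term [k] involves [A k] and [A (S k)], so cutting at [N] keeps the last jump, from [A N] to
     [A (S N) = 0]; the boundary flux then vanishes too. *)
  - rewrite (Series_eventually_0 _ N).
    2:{ intros k Hk. rewrite (HN (S k)), (HN (S k - 1)%nat) by lia.
        replace (Cminus (RtoC 0) (RtoC 0)) with (RtoC 0) by ring.
        rewrite Cmod_0. ring. }
    pose proof (partial_hardy alpha A N hA0) as H.
    rewrite (HN (S N)), Cmod_0 in H by lia. lra.
  (* As [A 0 = 0], the nonzero entry has index [S j]; its term supplies the strictness. *)
  - intros [[| j] Hj]; [contradiction |].
    rewrite (Series_eventually_0 _ N)
      by (intros k Hk; rewrite (HN (S k)), Cmod_0 by lia;
          unfold Rdiv; ring).
    rewrite scal_sum. apply Rlt_gt.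
    assert (Hterm : forall k,
      Cmod (A (S k)) ^ 2 / INR (S k) ^ 2 * Rpower (INR (S k)) alpha
        * ((alpha - 1) ^ 2 / 4)
      = (alpha - 1) ^ 2 / 4 * (Rpower (INR (S k)) alpha / INR (S k) ^ 2)
        * Cmod (A (S k)) ^ 2) by (intros k; unfold Rdiv; ring).
    apply (sum_f_R0_lt _ _ N j).
    + intros k. rewrite Hterm. apply Rmult_le_compat_r; [apply pow2_ge_0 |].
      apply Rlt_le, hardy_weight_gt; [exact halpha | lia].
    + destruct (Nat.le_gt_cases j N) as [H | H]; [exact H |].
      exfalso. apply Hj, HN. lia.
    + rewrite Hterm. apply Rmult_lt_compat_r.
      * apply pow_lt, Cmod_gt_0, Hj.
      * apply hardy_weight_gt; [exact halpha | lia].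
Qed.
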